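(* Let $A$ be a finite quotient PID such that its ideal norm $N_A$ satisfies the quasi-triangle inequality, i.e. there exists a constant $C\in\mathbb{N}$ such that $N_A(x+y)\leq C\cdot(N_A(x)+N_A(y))$ for all $x,y\in A$. Then the field of fractions $K$ of $A$ is a global field and $A$ is a ring of integers of $K$.
   Context: All rings are commutative with identity; $\mathbb{N}$ denotes the set of positive integers; PID stands for principal ideal domain. A finite quotient PID is a PID $A$ such that for every nonzero ideal $I$ of $A$ the quotient $A/I$ is a finite ring. The ideal norm on $A$ is the function $N_A:A\to\mathbb{N}\cup\{0\}$ given by $N_A(x)=|A/xA|$ for $x\neq 0$ and $N_A(0)=0$. A global field is either a finite extension of $\mathbb{Q}$ (number field case) or a finite separable extension of some $\mathbb{F}_q(t)$, where $\mathbb{F}_q$ is a finite field and $t$ is transcendental over $\mathbb{F}_q$ (function field case). A ring of integers of a global field $K$ is either the integral closure in $K$ of $\mathbb{Z}$ (in the number field case) or the integral closure in $K$ of $\mathbb{F}_q[t]$ for some $t\in K$ transcendental over $\mathbb{F}_q$ (in the function field case); in the function field case it is thus not unique.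
   Formalization: The formal theorem additionally assumes that A is not a field; a field such as Q satisfies every stated hypothesis (norm 1 off zero, C = 1), but no field is a ring of integers of a global field, so the claim fails for fields. *)

(* Defs.v *)
From HB Require Import structures.
From mathcomp Require Import all_boot all_order all_algebra all_field.
From mathcomp Require Import fraction ring_quotient mxpoly finmap.
From mathcomp Require Import boolp classical_sets functions cardinality.

Set Implicit Arguments.
Unset Strict Implicit.
Unset Printing Implicit Defensive.

Import GRing.Theory.

Local Open Scope ring_scope.
Local Open Scope quotient_scope.
Local Open Scope classical_set_scope.

(* Ideals here may be the whole ring, unlike those of [idealr].  Since        *)
(* predicates are classically boolean, [{pred A}] covers all subsets of [A].  *)
Definition is_ideal (A : comNzRingType) (I : {pred A}) : Prop :=
  [/\ 0 \in I,
      {in I &, forall u v, u + v \in I} &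
      forall a, {in I, forall u, a * u \in I}].

Definition principal_ideal (A : comNzRingType) (x : A) : {pred A} :=
  fun y => `[< exists z, y = x * z >].

Lemma principal_ideal_zmod_closed (A : comNzRingType) (x : A) :
  zmod_closed (principal_ideal x).
Proof.
split; first by apply/asboolP; exists 0; rewrite mulr0.
move=> _ _ /asboolP[u ->] /asboolP[v ->].
by apply/asboolP; exists (u - v); rewrite mulrBr.
Qed.

HB.instance Definition _ (A : comNzRingType) (x : A) :=
  GRing.isZmodClosed.Build A (principal_ideal x)
    (principal_ideal_zmod_closed x).

Definition is_pid (A : idomainType) : Prop :=
  forall I : {pred A}, is_ideal I -> exists a, I =i principal_ideal a.

(* For an ideal [I] that may be the whole ring, the library only makes        *)
(* [{ideal_quot I}] an additive group, which is enough to count its elements. *)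
Definition finite_quotients (A : idomainType) : Prop :=
  forall I : zmodClosed A, is_ideal I -> (exists2 x, x \in I & x != 0) ->
    finite_set [set: {ideal_quot I}].

Definition finite_quotient_pid (A : idomainType) : Prop :=
  is_pid A /\ finite_quotients A.

(* [fset_set] is the empty set on infinite sets, so the value is meaningful   *)
(* only when [A / xA] is finite.                                              *)
Definition ideal_norm (A : idomainType) (x : A) : nat :=
  if x == 0 then 0%N
  else #|` fset_set [set: {ideal_quot (principal_ideal x)}]|%fset.

Definition quasi_triangle (A : idomainType) (N : A -> nat) : Prop :=
  exists2 C : nat, (0 < C)%N & forall x y, (N (x + y)%R <= C * (N x + N y))%N.

Definition field_isomorphic (K L : fieldType) : Prop :=
  exists f : {rmorphism K -> L}, bijective f.

Definition number_field (K : fieldType) : Prop :=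
  exists L : fieldExtType rat, field_isomorphic K L.

Definition function_field (F : finFieldType) (K : fieldType) : Prop :=
  exists2 L : fieldExtType {fraction {poly F}},
    separable 1%VS {:L} & field_isomorphic K L.

Definition global_field (K : fieldType) : Prop :=
  number_field K \/ exists F : finFieldType, function_field F K.

Definition integral_closure (R : nzRingType) (K : fieldType) (RtoK : R -> K)
  : set K := [set z | integralOver RtoK z].

(* In the second case [iota] embeds F_q into [K] and                          *)
(* [fun p => (map_poly iota p).[t]] is the inclusion of F_q[t] into [K]; [t]  *)
(* is any transcendental element, not only one making [K] separable.          *)
Definition ring_of_integers (K : fieldType) (S : set K) : Prop :=
  (number_field K /\ S = integral_closure (fun n : int => n%:~R : K)) \/
  (exists F : finFieldType, function_field F K /\
   exists (iota : {rmorphism F -> K}) (t : K),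
     ~ algebraicOver iota t /\
     S = integral_closure (fun p : {poly F} => (map_poly iota p).[t])).

(* Main.v *)
Require Import Defs.
From mathcomp Require Import all_boot all_order all_algebra all_field.
From mathcomp Require Import fraction boolp classical_sets.
From HB Require Import structures.
From mathcomp Require Import ring_quotient mxpoly finmap cardinality zify.

(** The ideal norm [N] is multiplicative ([ideal_normM]), and an element of
    norm below [N a] is divisible by [a] only if it is zero. With the
    quasi-triangle inequality, congruent elements that are small compared with
    the modulus are therefore equal, and balls are finite.

    The heart of the proof is expansion in a base. Let [b] be an element of [A]
    with [2 * C <= N b]. Repeated division of [a] by [b], with remainders in a
    fixed residue system, writes [a] as a sum of digits times
    powers of [b] plus [b ^ k * a']. The norm of the digit sum is [O(N b ^ k)],
    so for large [k] the norm of [a'] is bounded independently of [a]. Hence [A]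
    is finitely generated over any subring containing [b]
    ([finitely_generated]). In characteristic 0 a suitable integer serves as
    [b], the integers having unbounded norms. In characteristic [p] any nonunit
    [t] of large norm does, and it is transcendental over [F_p]. So [A] is a
    finitely generated module over Z or over [F_p[t]], and all its elements are
    integral ([integral_in_span]). A principal ideal domain is integrally closed
    ([integrally_closed]), so [A] is exactly the integral closure; and its field
    of fractions [K] is spanned over Q or [F_p(t)] by the same generators
    ([in_span_fraction], [finite_extension]).

    In characteristic [p] it remains to choose [t] so that [K] is separable over
    [F_p(t)]. The choice is [t = pi * s ^ p] with [pi] prime, so that
    [1, t, ..., t ^ (p - 1)] are linearly independent over the field of [p]-th
    powers, by comparing [pi]-adic valuations ([pth_powers_independent]).
    Counting elements of bounded norm shows that they also span [K] over the
    field of [p]-th powers: adjoining a further [y] would yield about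
    [B ^ (2 * p)] combinations of norm [O(B ^ p)] ([pth_power_relation]). So
    [K = K^p(t)], which implies separability ([separable_of_relations]). *)

Set Implicit Arguments.
Unset Strict Implicit.
Unset Printing Implicit Defensive.

Import GRing.Theory.

Local Open Scope ring_scope.
Local Open Scope quotient_scope.

Local Notation tofrac := (@FracField.tofrac _).

(** * The ideal norm is multiplicative *)

Lemma principal_idealP (A : comNzRingType) (x a : A) :
  reflect (exists z, a = x * z) (a \in principal_ideal x).
Proof. exact: asboolP. Qed.

Lemma principal_is_ideal (A : comNzRingType) (x : A) :
  is_ideal (principal_ideal x).
Proof.
split=> [|u v|a u]; [exact: rpred0|exact: rpredD|].
case/principal_idealP=> z ->; apply/principal_idealP; exists (a * z).
by rewrite mulrCA.
Qed.

Lemma principal_ideal_gen (A : comNzRingType) (x : A) : x \in principal_ideal x.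
Proof. by apply/principal_idealP; exists 1; rewrite mulr1. Qed.

Lemma principal_idealMr (A : comNzRingType) (x a b : A) :
  a \in principal_ideal x -> a * b \in principal_ideal x.
Proof. by rewrite mulrC; case: (principal_is_ideal x) => _ _; apply. Qed.

Lemma principal_idealM2l (A : idomainType) (x y a : A) : x != 0 ->
  (x * a \in principal_ideal (x * y)) = (a \in principal_ideal y).
Proof.
move=> x0; apply/principal_idealP/principal_idealP=> -[z].
  by rewrite -mulrA => /(mulfI x0) ->; exists z.
by move=> ->; exists z; rewrite mulrA.
Qed.

Section IdealNorm.

Variable A : idomainType.
Hypothesis finA : finite_quotients A.

Local Notation N := (@ideal_norm A).

Lemma ideal_norm0 : N 0 = 0%N.
Proof. by rewrite /ideal_norm eqxx. Qed.

Lemma enum_quotient (x : A) : x != 0 ->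
  exists s : seq {ideal_quot (principal_ideal x)},
    [/\ uniq s, size s = N x & forall q, q \in s].
Proof.
move=> x0; have fin: finite_set [set: {ideal_quot (principal_ideal x)}]%classic.
  apply: finA; first exact: principal_is_ideal.
  by exists x => //; apply: principal_ideal_gen.
exists (fset_set [set: {ideal_quot (principal_ideal x)}]%classic).
split; [exact: fset_uniq| |].
  by rewrite /ideal_norm (negPf x0).
by move=> q; rewrite (in_fset_set fin) mem_set.
Qed.

(** Pigeonhole on residue classes, for a family rather than a set so that it also
    detects coincidences among the combinations in [pth_power_relation]. *)
Lemma congruent_pair (I : eqType) (f : I -> A) (U : seq I) (x : A) :
  x != 0 -> uniq U -> (N x < size U)%N ->
  exists i j, [/\ i \in U, j \in U, i != j & f i - f j \in principal_ideal x].
Proof.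
move=> x0 uU ltU; have [s [us sz all_s]] := enum_quotient x0.
pose g i := \pi_{ideal_quot (principal_ideal x)} (f i).
have : ~~ uniq [seq g i | i <- U].
  apply: contraL ltU => uW; rewrite -leqNgt -sz -(size_map g).
  by apply: uniq_leq_size => // q _; apply: all_s.
case: U uU {ltU} => [//|i0 U] uU; move/(uniqPn (g i0)) => [a [b [ab bs]]].
rewrite size_map in bs; have as_ := ltn_trans ab bs.
rewrite !(nth_map i0) //.
exists (nth i0 (i0 :: U) a), (nth i0 (i0 :: U) b); split; try exact: mem_nth.
  by rewrite nth_uniq // ltn_eqF.
by rewrite Quotient.idealrBE; apply/eqP.
Qed.

(** A complete system of representatives: it lets the quotient type be dropped
    in favour of congruences between elements of [A]. *)
Lemma residues (x : A) : x != 0 ->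
  exists T : seq A, [/\ uniq T, size T = N x,
    {in T &, forall s s', s - s' \in principal_ideal x -> s = s'} &
    forall a, exists2 s, s \in T & a - s \in principal_ideal x].
Proof.
move=> x0; have [s [us sz all_s]] := enum_quotient x0.
exists [seq repr q | q <- s]; split; last first.
- move=> a; exists (repr (\pi_{ideal_quot (principal_ideal x)} a)).
    by apply: map_f; apply: all_s.
  by rewrite Quotient.idealrBE reprK.
- move=> _ _ /mapP[q _ ->] /mapP[q' _ ->]; rewrite Quotient.idealrBE !reprK.
  by move/eqP->.
- by rewrite size_map.
by rewrite map_inj_uniq //; exact: (can_inj reprK).
Qed.

Lemma leq_norm_cover (x : A) (T : seq A) : x != 0 ->
  (forall a, exists2 s, s \in T & a - s \in principal_ideal x) ->
  (N x <= size T)%N.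
Proof.
move=> x0 cov; have [s [us <- all_s]] := enum_quotient x0.
rewrite -(size_map \pi_{ideal_quot (principal_ideal x)}).
apply: uniq_leq_size => // q _; have [t tT] := cov (repr q).
by rewrite Quotient.idealrBE reprK => /eqP->; apply: map_f.
Qed.

Lemma leq_separated_norm (x : A) (T : seq A) : x != 0 -> uniq T ->
  {in T &, forall s s', s - s' \in principal_ideal x -> s = s'} ->
  (size T <= N x)%N.
Proof.
move=> x0 uT sep; rewrite leqNgt; apply/negP => ltT.
have [i [j [iT jT /eqP ij /(sep _ _ iT jT)]]] := congruent_pair id x0 uT ltT.
exact: ij.
Qed.

(** If [s] runs through residues modulo [x] and [t] through residues modulo
    [y], then [s + x * t] runs through residues modulo [x * y]. *)
Lemma ideal_normM : {morph N : x y / x * y >-> (x * y)%N}.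
Proof.
move=> x y; have [->|x0] := eqVneq x 0; first by rewrite mul0r ideal_norm0.
have [->|y0] := eqVneq y 0; first by rewrite mulr0 ideal_norm0 muln0.
have xy0 : x * y != 0 by rewrite mulf_neq0.
have [S [uS <- sepS covS]] := residues x0.
have [T [uT <- sepT covT]] := residues y0.
have injST : {in [seq (s, t) | s <- S, t <- T] &,
    forall u v, (u.1 + x * u.2) - (v.1 + x * v.2) \in principal_ideal (x * y) ->
      u = v}.
  move=> _ _ /allpairsP[[s t] /= [sS tT ->]] /allpairsP[[s' t'] /= [s'S t'T ->]].
  rewrite /= opprD addrACA -mulrBr => dST.
  have ss' : s = s'.
    apply: sepS => //; case/principal_idealP: dST => z dz.
    apply/principal_idealP; exists (y * z - (t - t')).
    by rewrite mulrBr mulrA -dz addrK.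
  move: dST; rewrite ss' subrr add0r principal_idealM2l // => /(sepT _ _ tT t'T).
  by move->.
set W := [seq u.1 + x * u.2 | u <- [seq (s, t) | s <- S, t <- T]].
have szW : size W = (size S * size T)%N by rewrite size_map size_allpairs.
have uW : uniq W.
  rewrite map_inj_in_uniq; first by rewrite allpairs_uniq // => -[? ?] [].
  by move=> u v uI vI /= e; apply: injST => //; rewrite e subrr rpred0.
apply/eqP; rewrite -szW eqn_leq; apply/andP; split.
  apply: leq_norm_cover => // a; have [s sS /principal_idealP[b ab]] := covS a.
  have [t tT /principal_idealP[c bc]] := covT b.
  exists (s + x * t).
    by apply/mapP; exists (s, t) => //; apply/allpairsP; exists (s, t).
  apply/principal_idealP; exists c; rewrite opprD addrA ab.
  by rewrite -mulrBr bc mulrA.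
apply: leq_separated_norm => // _ _ /mapP[u uI ->] /mapP[v vI ->] h.
by rewrite (injST u v).
Qed.

Lemma ideal_normX x n : N (x ^+ n) = (N x ^ n)%N.
Proof.
have N1 : N 1 = 1%N.
  apply/eqP; rewrite eqn_leq; apply/andP; split.
    apply: (@leq_norm_cover 1 [:: 0]); first exact: oner_neq0.
    move=> a; exists 0; rewrite ?inE //.
    by apply/principal_idealP; exists a; rewrite mul1r subr0.
  apply: (@leq_separated_norm 1 [:: 0]) => //; first exact: oner_neq0.
  by move=> ? ?; rewrite !inE => /eqP-> /eqP->.
elim: n => [|n IH]; first by rewrite expr0.
by rewrite exprS ideal_normM IH expnS.
Qed.

Lemma ideal_norm_gt0 x : (0 < N x)%N = (x != 0).
Proof.
have [->|x0] := eqVneq x 0; first by rewrite ideal_norm0.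
apply: (@leq_separated_norm x [:: 0]) => //.
by move=> ? ?; rewrite !inE => /eqP-> /eqP->.
Qed.

Lemma ideal_norm_gt1 x : (1 < N x)%N = (x != 0) && (x \isn't a GRing.unit).
Proof.
have [->|x0 /=] := eqVneq x 0; first by rewrite ideal_norm0.
apply/idP/idP => [|nu].
  apply: contraL => ux; rewrite -leqNgt.
  apply: (@leq_norm_cover x [:: 0]) => // a; exists 0; first by rewrite inE.
  by apply/principal_idealP; exists (x^-1 * a); rewrite mulVKr ?subr0.
apply: (@leq_separated_norm x [:: 0; 1]) => //.
  by rewrite /= inE eq_sym oner_neq0.
have n1 : 1 \notin principal_ideal x.
  by apply: contra nu => /principal_idealP[z /esym xz]; apply/unitrPr; exists z.
move=> s s'; rewrite !inE => /orP[]/eqP-> /orP[]/eqP-> //;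
  by rewrite ?sub0r ?subr0 ?rpredN (negPf n1).
Qed.

Lemma ideal_normN x : N (- x) = N x.
Proof.
have [->|x0] := eqVneq x 0; first by rewrite oppr0.
have e y : y != 0 -> (N (- y) <= N y)%N.
  move=> y0; have [T [_ <- _ cov]] := residues y0.
  apply: leq_norm_cover; rewrite ?oppr_eq0 // => a.
  have [s sT /principal_idealP[z az]] := cov a; exists s => //.
  by apply/principal_idealP; exists (- z); rewrite mulrNN.
by apply/eqP; rewrite eqn_leq e // -{1}[x]opprK e ?oppr_eq0.
Qed.

Lemma norm_dvd x a : a \in principal_ideal x -> a != 0 -> (N x <= N a)%N.
Proof.
move=> /principal_idealP[z ->] xz0; rewrite ideal_normM leq_pmulr //.
by rewrite ideal_norm_gt0; apply: contraNneq xz0 => ->; rewrite mulr0.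
Qed.

End IdealNorm.

(** * Finite generation from the quasi-triangle inequality *)

Section QuasiTriangle.

Variable A : idomainType.
Hypothesis finA : finite_quotients A.
Local Notation N := (@ideal_norm A).

Variable C : nat.
Hypothesis triN : forall x y, (N (x + y)%R <= C * (N x + N y))%N.

(** A nonzero multiple of [a] has norm at least [N a], so small elements are
    determined by their class modulo [a]. *)
Lemma small_congruent_eq (x y a : A) (B : nat) :
  (N x <= B)%N -> (N y <= B)%N -> (C * (B + B) < N a)%N ->
  x - y \in principal_ideal a -> x = y.
Proof.
move=> xB yB Ba dv; apply/eqP; rewrite -subr_eq0; apply/negPn/negP => n0.
have := norm_dvd finA dv n0; apply/negP; rewrite -ltnNge.
apply: leq_ltn_trans Ba; apply: leq_trans (triN _ _) _.
by rewrite ideal_normN // leq_mul2l leq_add ?orbT.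
Qed.

(** Adding the terms from the lowest power upwards costs a factor [2 * C] per
    digit, which the growth of [N b ^ k] absorbs as soon as [2 * C <= N b]. *)
Lemma norm_digits (b : A) (s : nat -> A) (D k : nat) :
  (C.*2 <= N b)%N -> (forall i, N (s i) <= D)%N ->
  (N (\sum_(i < k) s i * b ^+ i)%R <= D * N b ^ k)%N.
Proof.
move=> Cb sD; elim: k => [|k IH].
  by rewrite big_ord0 ideal_norm0.
rewrite big_ord_recr /=; apply: leq_trans (triN _ _) _.
have {}IH : (N (\sum_(i < k) s i * b ^+ i)%R + N (s k * b ^+ k)%R
    <= (D * N b ^ k).*2)%N.
  by rewrite -addnn leq_add // ideal_normM // ideal_normX // leq_mul2r sD orbT.
apply: leq_trans (leq_mul (leqnn C) IH) _.
have -> : (C * (D * N b ^ k).*2 = D * N b ^ k * C.*2)%N by rewrite -!muln2; lia.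
by rewrite expnSr mulnA leq_mul2l Cb orbT.
Qed.

Lemma digit_expansion (b : A) (T : seq A) (k : nat) (a : A) :
  (forall a, exists2 s, s \in T & a - s \in principal_ideal b) ->
  exists (s : nat -> A) (a' : A),
    (forall i, s i \in T) /\ a = \sum_(i < k) s i * b ^+ i + b ^+ k * a'.
Proof.
move=> cov; elim: k => [|k [s [a' [sT ->]]]].
  have [t tT _] := cov 0.
  by exists (fun=> t), a; rewrite big_ord0 add0r mul1r.
have [t tT /principal_idealP[c dc]] := cov a'.
exists (fun i => if i == k then t else s i), c; split.
  by move=> i; case: eqP.
rewrite big_ord_recr /= eqxx -addrA; congr (_ + _).
  by apply: eq_bigr => i _; rewrite ltn_eqF.
by rewrite exprSr -mulrA -dc mulrBr [t * _]mulrC addrC subrK.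
Qed.

(** By [small_congruent_eq], a ball contains at most one element of each residue
    class modulo a high power of [b]. *)
Lemma ball_finite (b : A) (B : nat) : (1 < N b)%N ->
  exists s : seq A, forall x, (N x <= B)%N -> x \in s.
Proof.
move=> b1; pose a := b ^+ (C * (B + B)).
have aB : (C * (B + B) < N a)%N by rewrite ideal_normX // ltn_expl.
have a0 : a != 0 by rewrite -ideal_norm_gt0 //; apply: leq_ltn_trans aB.
have [T [_ _ _ cov]] := residues finA a0.
have /choice[f fP] : forall t, exists y, forall x, (N x <= B)%N ->
    x - t \in principal_ideal a -> x = y.
  move=> t.
  have [[y [yB yt]]|no] :=
    pselect (exists y, (N y <= B)%N /\ y - t \in principal_ideal a); last first.
    by exists 0 => x xB xt; case: no; exists x.
  exists y => x xB xt; apply: small_congruent_eq xB yB aB _.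
  by rewrite -[x](subrK t) -addrA rpredD // -opprB rpredN.
exists (map f T) => x xB; have [t tT xt] := cov x.
by rewrite (fP _ _ xB xt) map_f.
Qed.

End QuasiTriangle.

(** The coefficients are indexed by [nat], so that spans of different families
    can be combined without casts. *)
Definition in_span (R A : nzRingType) (g : R -> A) (w : seq A) (a : A) : Prop :=
  exists c : nat -> R, a = \sum_(i < size w) g (c i) * w`_i.

Section Span.
Variables (R A : nzRingType) (g : {rmorphism R -> A}) (w : seq A).

Lemma in_span0 : in_span g w 0.
Proof. by exists (fun=> 0); rewrite big1 // => i _; rewrite rmorph0 mul0r. Qed.

Lemma in_spanD a b : in_span g w a -> in_span g w b -> in_span g w (a + b).
Proof.
move=> [c ->] [d ->]; exists (fun i => c i + d i); rewrite -big_split /=.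
by apply: eq_bigr => i _; rewrite rmorphD mulrDl.
Qed.

Lemma in_spanZ r a : in_span g w a -> in_span g w (g r * a).
Proof.
move=> [c ->]; exists (fun i => r * c i); rewrite mulr_sumr.
by apply: eq_bigr => i _; rewrite rmorphM mulrA.
Qed.

Lemma in_span_mem a : a \in w -> in_span g w a.
Proof.
move=> aw; have lt_w : (index a w < size w)%N by rewrite index_mem.
exists (fun i => (i == index a w)%:R).
rewrite (bigD1 (Ordinal lt_w)) //= eqxx rmorph1 mul1r nth_index // big1 ?addr0 //.
move=> i /negPf ni; rewrite -(inj_eq val_inj) /= in ni.
by rewrite ni rmorph0 mul0r.
Qed.

Lemma in_span_sum n (F : 'I_n -> A) :
  (forall i, in_span g w (F i)) -> in_span g w (\sum_(i < n) F i).
Proof. by move=> h; apply: big_ind => //; [exact: in_span0|exact: in_spanD]. Qed.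

End Span.

(** Let [b] be the image of [r]. Expanding [a] in base [b] with digits in a
    residue system modulo [b] leaves after [k] steps a quotient [a'] such that
    [b ^ k * a'] is [a] minus a sum of norm [O(N b ^ k)]. Once [N b ^ k]
    exceeds [N a], the norm of [a'] is below a bound that does not depend on
    [a]. The digits together with the ball of that radius therefore generate
    [A] over any subring that contains [b]. *)
Lemma finitely_generated (A : idomainType) (R : nzRingType)
    (g : {rmorphism R -> A}) (C : nat) (r : R) :
  finite_quotients A -> (0 < C)%N ->
  (forall x y : A,
    (ideal_norm (x + y)%R <= C * (ideal_norm x + ideal_norm y))%N) ->
  (C.*2 <= ideal_norm (g r))%N ->
  exists w : seq A, forall a, in_span g w a.
Proof.
move=> finA C0 tri big_r; set b := g r in big_r.
have Q1 : (1 < ideal_norm b)%N by apply: leq_trans big_r; rewrite -addnn; lia.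
have b0 : b != 0 by rewrite -(ideal_norm_gt0 finA) ltnW.
have [T [_ _ _ cov]] := residues finA b0.
pose D := \max_(t <- T) ideal_norm t.
have TD t : t \in T -> (ideal_norm t <= D)%N by move=> tT; apply: leq_bigmax_seq.
have [S ballS] := ball_finite finA tri (C * (1 + D)) Q1.
exists (T ++ S) => a; pose k := ideal_norm a.
have [s [a' [sT ea]]] := digit_expansion k a cov.
have gX i : b ^+ i = g (r ^+ i) by rewrite rmorphXn.
rewrite ea; apply: in_spanD.
  apply: in_span_sum => i; rewrite mulrC gX; apply: in_spanZ.
  by apply: in_span_mem; rewrite mem_cat sT.
rewrite gX; apply/in_spanZ/in_span_mem; rewrite mem_cat; apply/orP; right.
apply: ballS; have Qk : (0 < ideal_norm b ^ k)%N by rewrite expn_gt0 ltnW.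
rewrite -(leq_pmul2r Qk) -ideal_normX // -ideal_normM //.
have -> : a' * b ^+ k = a + - (\sum_(i < k) s i * b ^+ i).
  by rewrite [in RHS]ea addrC addKr mulrC.
apply: leq_trans (tri _ _) _; rewrite -mulnA leq_mul2l; apply/orP; right.
rewrite mulnDl mul1n ideal_normN // leq_add //.
  by rewrite ideal_normX // ltnW // ltn_expl.
by rewrite ideal_normX // (norm_digits finA tri) // => i; apply: TD.
Qed.

(** * Divisibility in a principal ideal domain *)

Lemma fractionP (R : idomainType) (z : {fraction R}) :
  exists x y : R, y != 0 /\ z = tofrac x / tofrac y.
Proof.
elim/quotW: z => r; exists (frac r).1, (frac r).2.
have d0 : (frac r).2 != 0 by case: r.
split=> //; apply: (canRL (mulfK _)); first by rewrite tofrac_eq0.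
unlock FracField.tofrac; rewrite -[LHS]FracField.pi_mul; apply/eqmodP.
rewrite /= /FracField.equivf /FracField.mulf !numden_Ratio ?oner_eq0 ?mulr1 //.
by rewrite mulrC.
Qed.

Lemma integralOver_expr (R K : nzRingType) (f : {rmorphism R -> K}) (z : K) :
  integralOver f z ->
  exists n (c : nat -> R), z ^+ n = - \sum_(i < n) f (c i) * z ^+ i.
Proof.
case=> p monp /eqP pz0; pose n := (size p).-1; exists n, (nth 0 p).
have szp : size p = n.+1 by rewrite /n polySpred ?monic_neq0.
apply/eqP; rewrite -addr_eq0 addrC -[X in _ == X]pz0.
rewrite (@horner_coef_wide _ n.+1) -?szp ?size_poly // szp big_ord_recr /=.
apply/eqP; congr (_ + _).
  by apply: eq_bigr => i _; rewrite coef_map.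
by rewrite coef_map /= (monicP monp : p`_n = 1) rmorph1 mul1r.
Qed.

Section PID.

Variable A : idomainType.
Hypothesis pidA : is_pid A.

Lemma bezout (x y : A) : exists d u v,
  [/\ d = u * x + v * y, x \in principal_ideal d & y \in principal_ideal d].
Proof.
pose I : {pred A} := fun z => `[< exists u v, z = u * x + v * y >].
have idI : is_ideal I.
  split.
  - by apply/asboolP; exists 0, 0; rewrite !mul0r addr0.
  - move=> _ _ /asboolP[u [v ->]] /asboolP[u' [v' ->]]; apply/asboolP.
    by exists (u + u'), (v + v'); rewrite !mulrDl addrACA.
  - move=> a _ /asboolP[u [v ->]]; apply/asboolP.
    by exists (a * u), (a * v); rewrite mulrDr !mulrA.
have [d Id] := pidA idI.
have /asboolP[u [v duv]] : d \in I by rewrite Id principal_ideal_gen.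
exists d, u, v; rewrite -!Id; split=> //; apply/asboolP.
  by exists 1, 0; rewrite mul0r mul1r addr0.
by exists 0, 1; rewrite mul0r mul1r add0r.
Qed.

(** A nonunit of least norm is irreducible, hence prime by [bezout]. *)
Lemma prime_exists : finite_quotients A -> ~ GRing.field_axiom A ->
  exists2 pi : A, (1 < ideal_norm pi)%N &
    forall a b, a * b \in principal_ideal pi ->
      a \in principal_ideal pi \/ b \in principal_ideal pi.
Proof.
move=> finA nfA.
have ex_n : exists n, `[< exists2 x : A, ideal_norm x = n & (1 < n)%N >].
  have /existsNP[x /not_implyP[x0 /negP ux]] := nfA.
  by exists (ideal_norm x); apply/asboolP; exists x; rewrite ?ideal_norm_gt1 ?x0.
have [_ /asboolP[pi <- pi1] min_pi] := ex_minnP ex_n.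
exists pi => // a b ab.
have pi0 : pi != 0 by move: pi1; rewrite ideal_norm_gt1 // => /andP[].
have [d [u [v [duv /principal_idealP[e pie] da]]]] := bezout pi a.
have [ud|nud] := boolP (d \is a GRing.unit); [right|left].
  rewrite -[b](mulKr ud) duv mulrC mulrDl principal_idealMr // rpredD //.
    by rewrite mulrAC mulrC !principal_idealMr // principal_ideal_gen.
  by rewrite -mulrA mulrC principal_idealMr.
have d0 : d != 0 by apply: contraNneq pi0 => d0; rewrite pie d0 mul0r.
have e0 : e != 0 by apply: contraNneq pi0 => e0; rewrite pie e0 mulr0.
have ue : e \is a GRing.unit.
  apply/negPn/negP => ne.
  have d1 : (1 < ideal_norm d)%N by rewrite ideal_norm_gt1 // d0.
  have : (ideal_norm pi <= ideal_norm d)%N by apply: min_pi; apply/asboolP; exists d.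
  rewrite pie ideal_normM // leqNgt ltn_Pmulr ?(ltnW d1) //.
  by rewrite ideal_norm_gt1 // e0.
case/principal_idealP: da => z ->; apply/principal_idealP; exists (e^-1 * z).
by rewrite pie -mulrA mulVKr.
Qed.

(** A monic equation for a fraction [a / b] in lowest terms shows that [b]
    divides a power of [a]; as [a] is invertible modulo [b], the denominator is
    a unit. *)
Lemma integrally_closed (R : nzRingType) (g : {rmorphism R -> A})
    (z : {fraction A}) :
  integralOver (tofrac \o g) z -> exists a : A, z = tofrac a.
Proof.
move=> /integralOver_expr[n [c zn]].
have [x [y [y0 zxy]]] := fractionP z.
have [d [u [v [duv /principal_idealP[a xa] /principal_idealP[b yb]]]]] :=
  bezout x y.
have [d0 b0] : d != 0 /\ b != 0 by apply/andP; rewrite -negb_or -mulf_eq0 -yb.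
have uv1 : u * a + v * b = 1.
  apply: (mulfI d0).
  by rewrite mulr1 [RHS]duv xa yb mulrDr mulrCA [d * (v * b)]mulrCA.
have bF0 : tofrac b != 0 by rewrite tofrac_eq0.
have zb : z * tofrac b = tofrac a.
  rewrite zxy xa yb !rmorphM /= invfM mulrACA.
  by rewrite divff ?tofrac_eq0 // mul1r mulfVK.
have an : a ^+ n \in principal_ideal b.
  apply/principal_idealP.
  exists (- \sum_(i < n) g (c i) * a ^+ i * b ^+ (n - i).-1).
  apply/eqP; rewrite -tofrac_eq mulrN mulr_sumr rmorphN rmorphXn rmorph_sum /=.
  rewrite -zb exprMn zn mulNr mulr_suml; apply/eqP; congr (- _).
  apply: eq_bigr => i _; rewrite !rmorphM !rmorphXn /= -zb exprMn.
  rewrite mulrCA -!mulrA; congr (_ * (_ * _)); rewrite -exprS -exprD.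
  by rewrite prednK ?subn_gt0 // subnKC // ltnW.
have : 1 \in principal_ideal b.
  elim: n an {zn} => [|n' IH]; rewrite ?expr0 // exprSr => an; apply: IH.
  rewrite -[a ^+ n']mulr1 -uv1 mulrDr rpredD //.
    by rewrite mulrCA mulrC principal_idealMr.
  by rewrite mulrA mulrC principal_idealMr // principal_ideal_gen.
case/principal_idealP=> e /esym be; exists (a * e).
by rewrite rmorphM /= -zb -mulrA -rmorphM be rmorph1 mulr1.
Qed.

End PID.

(** * Integrality and the field of fractions *)

(** Cayley-Hamilton: [a] is an eigenvalue of the matrix of multiplication by [a]
    on the generators. *)
Lemma integral_in_span (R : comNzRingType) (A : idomainType)
    (g : {rmorphism R -> A}) (w : seq A) (a : A) :
  (forall b, in_span g w b) -> integralOver (tofrac \o g) (tofrac a).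
Proof.
move=> span_w; have /choice[M MP] : forall i : nat, exists c : nat -> R,
    a * w`_i = \sum_(j < size w) g (c j) * w`_j by move=> i; apply: span_w.
pose B := \matrix_(i < size w, j < size w) M j i.
exists (char_poly B); first exact: char_poly_monic.
rewrite (map_char_poly (tofrac \o g)) -eigenvalue_root_char.
apply/eigenvalueP; exists (\row_(j < size w) tofrac w`_j).
  apply/rowP => j; rewrite !mxE -rmorphM MP rmorph_sum /=.
  by apply: eq_bigr => i _; rewrite !mxE rmorphM mulrC.
apply/eqP => /rowP v0; have [c /eqP] := span_w 1.
rewrite big1 ?oner_eq0 // => i _; have /eqP := v0 i.
by rewrite !mxE tofrac_eq0 => /eqP->; rewrite mulr0.
Qed.

(** Every [y] in [A] is integral, so [1 / y] is a polynomial in [y] with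
    coefficients in [E]; the [E]-span of [A] is thus already a field. *)
Lemma in_span_fraction (R : comNzRingType) (A : idomainType) (E : fieldType)
    (g : {rmorphism R -> A}) (j : {rmorphism R -> E})
    (h : {rmorphism E -> {fraction A}}) (w : seq A) (z : {fraction A}) :
  (forall r, h (j r) = tofrac (g r)) ->
  (forall a, in_span g w a) -> in_span h (map tofrac w) z.
Proof.
move=> hj span_w.
have spanA a : in_span h (map tofrac w) (tofrac a).
  have [c ->] := span_w a; exists (j \o c); rewrite size_map rmorph_sum.
  by apply: eq_bigr => i _; rewrite (nth_map 0) //= hj rmorphM.
have [x [y [y0 ->]]] := fractionP z.
have yF0 : tofrac y != 0 by rewrite tofrac_eq0.
have inty : integralOver h (tofrac y).
  have [p monp py] := integral_in_span y span_w; exists (map_poly j p).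
    exact: monic_map.
  rewrite -map_poly_comp (_ : map_poly (h \o j) p = map_poly (tofrac \o g) p) //.
  by apply: eq_map_poly => r /=; rewrite hj.
have [n [c zn]] := integralOver_expr (integral_inv inty).
have -> : tofrac x / tofrac y =
    \sum_(i < n) h (- c i) * tofrac (x * y ^+ (n.-1 - i)).
  (* The relation of degree [n] for [1 / y], multiplied by [x * y ^ (n - 1)]. *)
  case: n zn => [|n] zn.
    by move/eqP: zn; rewrite big_ord0 oppr0 oner_eq0.
  have -> : (tofrac y)^-1 = tofrac y ^+ n * (tofrac y)^-1 ^+ n.+1.
    by rewrite exprS mulrCA exprVn divff ?mulr1 // expf_neq0.
  rewrite zn !mulrN !mulr_sumr -sumrN; apply: eq_bigr => i _ /=.
  rewrite rmorphN mulNr !rmorphM rmorphXn /=; congr (- _).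
  have le_in : (i <= n)%N by rewrite -ltnS.
  have ey : tofrac y ^+ n * (tofrac y)^-1 ^+ i = tofrac y ^+ (n - i).
    by rewrite -{1}(subnK le_in) exprD -mulrA -exprMn divff // expr1n mulr1.
  by rewrite [tofrac y ^+ n * _]mulrCA ey mulrCA.
by apply: in_span_sum => i; apply: in_spanZ; apply: spanA.
Qed.

(** * Finite field extensions from spanning families *)

(** The copy of [K] that carries the [E]-algebra structure given by [h]. The
    basis is a parameter of the type because the finite-dimensional structure
    is read off from it. *)
Definition extension_along (E K : fieldType) (h : {rmorphism E -> K})
  (w : seq K)
  (basis_w : bijective (fun u : 'rV[E]_(size w) => \sum_i h (u 0 i) * w`_i))
  : Type := K.

Section ExtensionAlong.

Variables (E K : fieldType) (h : {rmorphism E -> K}) (w : seq K).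
Variable basis_w :
  bijective (fun u : 'rV[E]_(size w) => \sum_i h (u 0 i) * w`_i).

Local Notation L := (extension_along basis_w).

HB.instance Definition _ := GRing.Field.copy L K.

Let scale (e : E) (x : L) : L := h e * (x : K).

Let scaleA a b v : scale a (scale b v) = scale (a * b) v.
Proof. by rewrite /scale rmorphM mulrA. Qed.
Let scale1 : left_id 1 scale.
Proof. by move=> v; rewrite /scale rmorph1 mul1r. Qed.
Let scaleDr : right_distributive scale +%R.
Proof. by move=> e u v; rewrite /scale mulrDr. Qed.
Let scaleDl v : {morph scale^~ v : a b / a + b}.
Proof. by move=> a b; rewrite /scale rmorphD mulrDl. Qed.

HB.instance Definition _ :=
  GRing.Zmodule_isLmodule.Build E L scaleA scale1 scaleDr scaleDl.

Let scaleAl (a : E) (u v : L) : a *: (u * v) = (a *: u) * v.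
Proof. exact: mulrA. Qed.

HB.instance Definition _ := GRing.Lmodule_isLalgebra.Build E L scaleAl.

Let scaleAr (a : E) (u v : L) : a *: (u * v) = u * (a *: v).
Proof. exact: (@mulrCA K). Qed.

HB.instance Definition _ := GRing.Lalgebra_isAlgebra.Build E L scaleAr.

Let basis_ex : exists2 v2r : L -> 'rV[E]_(size w),
  cancel (fun u : 'rV[E]_(size w) => \sum_i h (u 0 i) * w`_i : L) v2r &
  cancel v2r (fun u => \sum_i h (u 0 i) * w`_i : L).
Proof. by case: basis_w => v2r; exists v2r. Qed.

Let vector_axiom : Vector.axiom (size w) L.
Proof.
pose f (u : 'rV[E]_(size w)) : L := \sum_i h (u 0 i) * w`_i.
have [v2r fK v2rK] := cid2 basis_ex.
exists v2r; last by exists f.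
have lin_f : linear f.
  move=> e u v; rewrite [RHS](_ : _ = h e * f u + f v) // mulr_sumr -big_split.
  by apply: eq_bigr => i _; rewrite !mxE rmorphD rmorphM mulrDl mulrA.
have fv : cancel v2r f by [].
by move=> e x y; apply: (can_inj fK); rewrite -/(f _) -[RHS]/(f _) lin_f !fv.
Qed.

HB.instance Definition _ := Lmodule_hasFinDim.Build E L vector_axiom.

End ExtensionAlong.

(** A spanning family of least size is a basis. *)
Lemma finite_extension (E K : fieldType) (h : {rmorphism E -> K}) (w : seq K) :
  (forall z, in_span h w z) ->
  exists (L : fieldExtType E) (f : {rmorphism K -> L}),
    bijective f /\ forall e, f (h e) = e%:A.
Proof.
move: w => w0 span_w0.
have ex_n : exists n,
    `[< exists2 w : seq K, size w = n & forall z, in_span h w z >].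
  by exists (size w0); apply/asboolP; exists w0.
have [_ /asboolP[w <- span_w] min_w] := ex_minnP ex_n.
pose f (u : 'rV[E]_(size w)) := \sum_i h (u 0 i) * w`_i.
have ker_f u : f u = 0 -> u = 0.
  move=> fu0; apply/eqP/negPn/negP => /eqP/rowP/existsNP[k /eqP].
  rewrite mxE => uk0; pose s := [seq w`_(val i) | i <- enum (predC1 k)].
  have : (size w <= size s)%N.
    apply: min_w; apply/asboolP; exists s => // z.
    have span_s (i : 'I_(size w)) : i != k -> in_span h s w`_i.
      by move=> ik; apply: in_span_mem; apply: map_f; rewrite mem_enum.
    have span_k : in_span h s w`_k.
      have -> : w`_k = \sum_(i < size w)
          h (if i == k then 0 else - (u 0 i / u 0 k)) * w`_i.
        apply: (mulfI (_ : h (u 0 k) != 0)); first by rewrite fmorph_eq0.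
        have -> : h (u 0 k) * w`_k = - \sum_(i | i != k) h (u 0 i) * w`_i.
          apply/eqP; rewrite -addr_eq0 -[X in _ == X]fu0 /f.
          by rewrite [X in _ == X](bigD1 k).
        rewrite [in RHS](bigD1 k) //= eqxx rmorph0 mul0r add0r mulr_sumr -sumrN.
        apply: eq_bigr => i /negPf->.
        by rewrite mulrA -rmorphM mulrN mulrCA divff // mulr1 rmorphN mulNr.
      apply: in_span_sum => i; have [->|ik] := eqVneq i k.
        by rewrite rmorph0 mul0r; apply: in_span0.
      by apply/in_spanZ/span_s.
    have [c ->] := span_w z; apply: in_span_sum => i; apply: in_spanZ.
    by have [->|] := eqVneq i k; [apply: span_k | apply: span_s].
  rewrite size_map -cardE cardC1 card_ord leqNgt ltn_predL.
  by rewrite (leq_ltn_trans _ (ltn_ord k)).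
have bij_f : bijective f.
  have /choice[c cK] z : exists u, f u = z.
    have [c zc] := span_w z; exists (\row_i c i); rewrite zc.
    by apply: eq_bigr => i _; rewrite mxE.
  exists c => // u; apply/eqP; rewrite -subr_eq0; apply/eqP/ker_f.
  have fB a b : f (a - b) = f a - f b.
    rewrite /f -sumrB; apply: eq_bigr => i _.
    by rewrite !mxE rmorphB mulrBl.
  by rewrite fB cK subrr.
exists (extension_along bij_f).
exists (idfun : {rmorphism K -> extension_along bij_f}).
split; first by exists id.
by move=> e; rewrite [RHS]mulr1.
Qed.

(** A hypothesis on the values of [j], rather than [E] being the type of
    fractions of [R], so that the rational numbers are covered as fractions of
    integers. *)
Lemma extend_to_fractions (R : comNzRingType) (E K : fieldType)
    (j : {rmorphism R -> E}) (g : {rmorphism R -> K}) :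
  injective j -> injective g ->
  (forall e, exists x y, y != 0 /\ e = j x / j y) ->
  exists h : {rmorphism E -> K}, forall r, h (j r) = g r.
Proof.
move=> inj_j inj_g frac_j.
have j0 y : (j y == 0) = (y == 0) by rewrite -(rmorph0 j) (inj_eq inj_j).
have g0 y : (g y == 0) = (y == 0) by rewrite -(rmorph0 g) (inj_eq inj_g).
have /choice[h hP] : forall e, exists z, forall x y, y != 0 -> e = j x / j y ->
    z = g x / g y.
  move=> e; have [x [y [y0 ->]]] := frac_j e.
  exists (g x / g y) => x' y' y'0 /eqP.
  rewrite eqr_div ?j0 // -!rmorphM (inj_eq inj_j) => /eqP exy.
  by apply/eqP; rewrite eqr_div ?g0 // -!rmorphM exy.
have hj r : h (j r) = g r.
  by rewrite (hP _ r 1) ?oner_eq0 // rmorph1 ?rmorph1 divr1.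
have hB : zmod_morphism h.
  move=> a b; have [x [y [y0 ea]]] := frac_j a.
  have [x' [y' [y'0 eb]]] := frac_j b.
  rewrite (hP _ _ _ y0 ea) (hP _ _ _ y'0 eb).
  have -> : g x / g y - g x' / g y' = g (x * y' - x' * y) / g (y * y').
    by rewrite -mulNr addf_div ?g0 // rmorphB !rmorphM mulNr.
  apply: hP; first by rewrite -j0 rmorphM mulf_neq0 ?j0.
  by rewrite ea eb -mulNr addf_div ?j0 // rmorphB !rmorphM mulNr.
have hM : monoid_morphism h.
  split=> [|a b]; first by rewrite -(rmorph1 j) hj rmorph1.
  have [x [y [y0 ea]]] := frac_j a; have [x' [y' [y'0 eb]]] := frac_j b.
  rewrite (hP _ _ _ y0 ea) (hP _ _ _ y'0 eb) mulf_div -!rmorphM.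
  apply: hP; first by rewrite -j0 rmorphM mulf_neq0 ?j0.
  by rewrite ea eb mulf_div -!rmorphM.
pose H : {rmorphism E -> K} := HB.pack h (GRing.isZmodMorphism.Build E K h hB)
  (GRing.isMonoidMorphism.Build E K h hM).
by exists H.
Qed.

(** * Relations between p-th powers *)

Section PrimePowers.

Variable A : idomainType.
Hypothesis finA : finite_quotients A.
Local Notation N := (@ideal_norm A).

Variable pi : A.
Hypothesis pi_gt1 : (1 < N pi)%N.
Hypothesis pi_prime : forall a b, a * b \in principal_ideal pi ->
  a \in principal_ideal pi \/ b \in principal_ideal pi.

Let pi_neq0 : pi != 0.
Proof. by rewrite -(ideal_norm_gt0 finA) ltnW. Qed.

Lemma prime_divX a n :
  a ^+ n \in principal_ideal pi -> a \in principal_ideal pi.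
Proof.
elim: n => [|n IH]; last by rewrite exprS => /pi_prime[].
case/principal_idealP=> u /esym; rewrite expr0 => pu.
by rewrite -[a]mul1r -pu -mulrA principal_idealMr // principal_ideal_gen.
Qed.

Lemma div_all_eq0 a : (forall n, a \in principal_ideal (pi ^+ n)) -> a = 0.
Proof.
move=> dv; apply/eqP/negPn/negP => a0.
have := norm_dvd finA (dv (N a)) a0; rewrite ideal_normX // leqNgt.
by rewrite ltn_expl.
Qed.

(** If [pi] divides [a i] for all [i < j], every term but the [j]-th one is
    divisible by [pi ^ (j + 1)]. *)
Lemma pth_powers_divisible p (a : nat -> A) : (0 < p)%N ->
  \sum_(i < p) a i ^+ p * pi ^+ i = 0 ->
  forall i, (i < p)%N -> a i \in principal_ideal pi.
Proof.
move=> p0 sum0; elim/ltn_ind => j IH jp; apply: (@prime_divX _ p).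
have div_le m n : (m <= n)%N -> pi ^+ n \in principal_ideal (pi ^+ m).
  move=> mn; apply/principal_idealP; exists (pi ^+ (n - m)).
  by rewrite -exprD subnKC.
have: a j ^+ p * pi ^+ j \in principal_ideal (pi ^+ j.+1).
  have -> : a j ^+ p * pi ^+ j =
      - \sum_(i < p | i != Ordinal jp) a i ^+ p * pi ^+ i.
    apply/eqP; rewrite -addr_eq0 -[X in _ == X]sum0.
    by rewrite [X in _ == X](bigD1 (Ordinal jp)).
  rewrite rpredN; apply: rpred_sum => i; rewrite -(inj_eq val_inj) /= => ij.
  have [lt_ij|le_ji] := ltnP i j.
    have /principal_idealP[b ->] := IH _ lt_ij (ltn_ord i).
    by rewrite exprMn -mulrA principal_idealMr // div_le.
  by rewrite mulrC principal_idealMr // div_le // ltn_neqAle eq_sym ij.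
by rewrite mulrC exprSr principal_idealM2l // expf_neq0.
Qed.

(** The nonzero terms have [pi]-adic valuations congruent to their indices
    modulo [p], hence pairwise distinct. The proof is an infinite descent that
    divides all coefficients by [pi], so that no valuation has to be defined. *)
Lemma pth_powers_independent p (s : A) (a : nat -> A) : (0 < p)%N -> s != 0 ->
  \sum_(i < p) a i ^+ p * (pi * s ^+ p) ^+ i = 0 ->
  forall i, (i < p)%N -> a i = 0.
Proof.
move=> p0 s0 sum0 i ip.
pose b i := a i * s ^+ i.
have {sum0} : \sum_(i < p) b i ^+ p * pi ^+ i = 0.
  rewrite -[RHS]sum0; apply: eq_bigr => k _.
  by rewrite !exprMn -!exprM -mulrA (mulnC p) [pi ^+ k * _]mulrC.
suff div n : forall b : nat -> A, \sum_(i < p) b i ^+ p * pi ^+ i = 0 ->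
    b i \in principal_ideal (pi ^+ n).
  move=> sum0; have /eqP : b i = 0 by apply: div_all_eq0 => n; apply: div.
  by rewrite mulf_eq0 expf_eq0 (negPf s0) andbF orbF => /eqP.
elim: n => [|n IH] {}b sum0.
  by apply/principal_idealP; exists (b i); rewrite mul1r.
have /choice[c bc] : forall k, exists c, (k < p)%N -> b k = pi * c.
  move=> k; have [kp|] := boolP (k < p)%N; last by exists 0.
  by have /principal_idealP[c ->] := pth_powers_divisible p0 sum0 kp; exists c.
rewrite bc // exprS principal_idealM2l //; apply: IH.
apply: (mulfI (expf_neq0 p pi_neq0)); rewrite mulr0 -[RHS]sum0 mulr_sumr.
by apply: eq_bigr => k _; rewrite (bc k) // exprMn mulrA.
Qed.

End PrimePowers.

Section PthPowerRelations.

Variable A : idomainType.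
Hypothesis finA : finite_quotients A.
Local Notation N := (@ideal_norm A).
Variable C : nat.
Hypothesis C_gt0 : (0 < C)%N.
Hypothesis triN : forall x y, (N (x + y)%R <= C * (N x + N y))%N.

Lemma norm_sum n (F : 'I_n -> A) B : (forall i, N (F i) <= B)%N ->
  (N (\sum_(i < n) F i)%R <= C ^ n * n * B)%N.
Proof.
elim: n F => [|n IH] F FB; first by rewrite big_ord0 ideal_norm0.
rewrite big_ord_recr /=; apply: leq_trans (triN _ _) _.
apply: leq_trans (_ : C * (C ^ n * n * B + C ^ n * B) <= _)%N.
  rewrite leq_mul2l leq_add ?orbT ?IH //.
  by rewrite (leq_trans (FB _)) // leq_pmull // expn_gt0 C_gt0.
by rewrite -mulnDl -mulnSr !mulnA expnS.
Qed.

(** The [k]-digit expansions in base [t] represent all classes modulo [t ^ k] by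
    elements of norm [O(N t ^ k)]. *)
Lemma small_residues (t : A) : (C.*2 <= N t)%N -> t != 0 ->
  exists D, forall k, exists S : seq A,
    [/\ uniq S, size S = (N t ^ k)%N &
        forall x, x \in S -> (N x <= D * N t ^ k)%N].
Proof.
move=> big_t t0; have [T [_ _ _ cov]] := residues finA t0.
pose D := \max_(s <- T) N s.
have TD s : s \in T -> (N s <= D)%N by move=> sT; apply: leq_bigmax_seq.
exists D => k; have [U [uU szU sepU _]] := residues finA (expf_neq0 k t0).
have /choice[e eP] : forall a, exists x,
    (N x <= D * N t ^ k)%N /\ a - x \in principal_ideal (t ^+ k).
  move=> a; have [s [a' [sT ea]]] := digit_expansion k a cov.
  exists (\sum_(i < k) s i * t ^+ i); split.
    by apply: (norm_digits finA triN) => // i; apply: TD.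
  by apply/principal_idealP; exists a'; rewrite {1}ea addrC addKr.
exists (map e U); split.
- rewrite map_inj_in_uniq // => a b aU bU eab; apply: sepU => //.
  have [[_ da] [_ db]] := (eP a, eP b).
  by rewrite -[a](subrK (e a)) -addrA rpredD // eab -opprB rpredN.
- by rewrite size_map szU ideal_normX.
by move=> _ /mapP[a _ ->]; case: (eP a).
Qed.

(** Over the field of [p]-th powers, [1, t, ..., t ^ (p - 1)] and [y] times these
    are dependent, for reasons of size. Write [Q = N t]. Coefficients chosen
    among [Q ^ k] elements of norm [O(Q ^ k)] give [Q ^ (2 * p * k)] choices
    and combinations of norm [O(Q ^ (p * k))]. For large [k] two combinations
    are congruent modulo a power of [t] of much larger norm, hence equal, and as
    [x |-> x ^ p] is additive the difference of the choices is a relation. *)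
Lemma pth_power_relation p (t y : A) : p \in [pchar A] -> (C.*2 <= N t)%N ->
  exists a b : 'I_p -> A,
    [\/ exists i, a i != 0 | exists i, b i != 0] /\
    \sum_(i < p) a i ^+ p * t ^+ i + y * \sum_(i < p) b i ^+ p * t ^+ i = 0.
Proof.
move=> charp big_t.
have Q1 : (1 < N t)%N by apply: leq_trans big_t; rewrite -addnn; lia.
have t0 : t != 0 by rewrite -(ideal_norm_gt0 finA) ltnW.
have p0 : (0 < p)%N by rewrite prime_gt0 // (pcharf_prime charp).
have [D smallD] := small_residues big_t t0.
pose G := (C * (C ^ p * p * (D ^ p * N t ^ p) * (1 + N y)))%N.
(* [G] bounds the norms of the combinations up to the factor
   [N t ^ (p * k)]; this [k] makes [N t ^ (k - 1)] exceed [2 * C * G]. *)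
pose k := (C * (G + G)).+1.
have [S [uS szS SD]] := smallD k.
pose I := {ffun 'I_p + 'I_p -> 'I_(size S)}.
pose F (phi : I) := \sum_(i < p) S`_(phi (inl i)) ^+ p * t ^+ i +
   y * \sum_(i < p) S`_(phi (inr i)) ^+ p * t ^+ i.
have normF phi : (N (F phi) <= G * N t ^ (p * k))%N.
  have bnd (r : 'I_p -> 'I_p + 'I_p) :
      (N (\sum_(i < p) S`_(phi (r i)) ^+ p * t ^+ i)%R <=
       C ^ p * p * (D ^ p * N t ^ p) * N t ^ (p * k))%N.
    rewrite -mulnA; apply: norm_sum => i.
    rewrite ideal_normM // !ideal_normX // mulnAC.
    rewrite leq_mul ?leq_pexp2l ?(ltnW Q1) ?(ltnW (ltn_ord i)) //.
    by rewrite (mulnC p k) expnM -expnMn leq_exp2r // SD // mem_nth.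
  apply: leq_trans (triN _ _) _; rewrite ideal_normM //.
  rewrite -mulnA leq_mul2l; apply/orP; right.
  rewrite mulnAC mulnDr muln1 leq_add ?bnd //.
  by rewrite mulnC leq_mul2r bnd orbT.
(* One less than the exponent of the number of choices, so that the pigeonhole
   applies modulo [t ^ m]. *)
pose m := (2 * p * k).-1.
have pk0 : (0 < p * k)%N by rewrite muln_gt0 p0.
have ltm : (N (t ^+ m) < size (enum {: I}))%N.
  rewrite -cardE card_ffun card_sum !card_ord szS ideal_normX // -expnM.
  by rewrite ltn_exp2l // /m; lia.
have [phi [psi [_ _ /eqP ne dv]]] :=
  congruent_pair finA F (expf_neq0 m t0) (enum_uniq {: I}) ltm.
have eF : F phi = F psi.
  apply: (small_congruent_eq finA triN (normF phi) (normF psi)) dv.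
  rewrite -mulnDl mulnA ideal_normX //.
  apply: leq_trans (_ : N t ^ k.-1 * N t ^ (p * k) <= _)%N.
    by rewrite ltn_mul2r expn_gt0 ltnW // ltn_expl.
  rewrite -expnD leq_exp2l // /m.
  have : (k <= p * k)%N by rewrite leq_pmull.
  by lia.
have frobB (x z : A) : (x - z) ^+ p = x ^+ p - z ^+ p.
  by rewrite -!(pFrobenius_autE charp) rmorphB.
exists (fun i => S`_(phi (inl i)) - S`_(psi (inl i))),
       (fun i => S`_(phi (inr i)) - S`_(psi (inr i))); split; last first.
  transitivity (F phi - F psi); last by rewrite eF subrr.
  rewrite /F opprD addrACA -mulrBr -!sumrB.
  by congr (_ + _ * _); apply: eq_bigr => i _; rewrite frobB mulrBl.
have /existsNP[u /eqP phu] : ~ forall u, phi u = psi u by move/ffunP.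
have nz : S`_(phi u) - S`_(psi u) != 0 by rewrite subr_eq0 nth_uniq.
by case: u nz {phu} => i nz; [left|right]; exists i.
Qed.

End PthPowerRelations.

(** * Separability *)

Lemma pchar_pnat (R : nzRingType) p e :
  p \in [pchar R] -> [pchar R].-nat (p ^ e)%N.
Proof.
move=> charp.
by rewrite (eq_pnat _ (pcharf_eq charp)) pnatX pnat_id // (pcharf_prime charp).
Qed.

Lemma expr_sum_pchar (R : comNzRingType) p e n (F : 'I_n -> R) :
  p \in [pchar R] ->
  (\sum_(i < n) F i) ^+ (p ^ e) = \sum_(i < n) F i ^+ (p ^ e).
Proof.
move=> charp; apply: (big_morph (fun x => x ^+ (p ^ e))).
  by move=> u v; apply: exprDn_pchar; apply: pchar_pnat.
by rewrite expr0n expn_eq0 eqn0Ngt prime_gt0 ?(pcharf_prime charp).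
Qed.

(** The exponents of the elements of a basis are bounded, and raising to the
    power [p ^ m] is additive. *)
Lemma uniform_inseparable_exponent (E : fieldType) (L : fieldExtType E)
    (S : {subfield L}) (p : nat) :
  p \in [pchar L] -> purely_inseparable S {:L} ->
  exists e, forall y : L, y ^+ (p ^ e) \in S.
Proof.
move=> charp /purely_inseparableP insS.
have /choice[e eP] : forall y : L, exists e, y ^+ (p ^ e) \in S.
  move=> y; have /purely_inseparable_elementP_pchar[n] := insS y (memvf y).
  by rewrite (eq_pnat _ (pcharf_eq charp)) => /p_natP[e ->]; exists e.
pose b := vbasis {:L}; pose m := \max_(y <- b) e y; exists m => y.
rewrite (coord_vbasis (memvf y)) expr_sum_pchar //.
apply: rpred_sum => i _; rewrite exprZn; apply: rpredZ.
have le_m : (e (b`_i)%R <= m)%N.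
  by apply: leq_bigmax_seq; rewrite ?mem_nth ?size_tuple.
by rewrite -(subnKC le_m) expnD exprM rpredX.
Qed.

(** Let [S] be the separable closure of [E] in [L]. The relation
    [U + y * V = 0] expresses [y ^ (p ^ n)] through [t] and [p ^ (n + 1)]-th
    powers of elements of [A]; if those powers lie in [S], so does
    [y ^ (p ^ n)]. Going down from the exponent that
    [uniform_inseparable_exponent] provides, [n = 0] gives [L = S]. *)
Lemma separable_of_relations (E : fieldType) (L : fieldExtType E)
    (A : idomainType) (F : {rmorphism A -> L}) (p : nat) (t : A) :
  p \in [pchar L] -> injective F -> (forall z, exists x y, z = F x / F y) ->
  F t \in 1%VS ->
  (forall a : nat -> A, \sum_(i < p) a i ^+ p * t ^+ i = 0 ->
     forall i, (i < p)%N -> a i = 0) ->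
  (forall y, exists a b : 'I_p -> A,
    [\/ exists i, a i != 0 | exists i, b i != 0] /\
    \sum_(i < p) a i ^+ p * t ^+ i + y * \sum_(i < p) b i ^+ p * t ^+ i = 0) ->
  separable 1%VS {:L}.
Proof.
move=> charp injF fracF tE indep rel.
have {}indep (a : 'I_p -> A) : \sum_(i < p) a i ^+ p * t ^+ i = 0 ->
    forall i, a i = 0.
  move=> sum0 i; have := indep (fun n => oapp a 0 (insub n)) _ _ (ltn_ord i).
  by rewrite valK; apply; rewrite -[RHS]sum0; apply: eq_bigr => k _; rewrite valK.
pose x0 := separable_generator 1%AS {:L}.
pose S := <<1; x0>>%AS.
have tS : F t \in S by apply: (subvP (subv_adjoin _ _)).
have [e eS] := uniform_inseparable_exponent charp
  (separable_generator_maximal {:L} 1%AS).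
have pow_sum n (a : 'I_p -> A) : (forall c, F c ^+ (p ^ n.+1) \in S) ->
    F (\sum_(i < p) a i ^+ p * t ^+ i) ^+ (p ^ n) \in S.
  move=> aS; rewrite rmorph_sum expr_sum_pchar //.
  apply: rpred_sum => i _; rewrite rmorphM !rmorphXn exprMn -exprM -expnS.
  by rewrite rpredM // !rpredX.
have {e eS} FS a : F a \in S.
  have {}eS c : F c ^+ (p ^ e) \in S by apply: eS.
  elim: e eS => [|e IH] eS; first by have := eS a; rewrite expr1.
  apply: IH => y; have [u [v [nz uv]]] := rel y.
  set U := \sum_(i < p) u i ^+ p * t ^+ i in uv.
  set V := \sum_(i < p) v i ^+ p * t ^+ i in uv.
  have V0 : V != 0.
    apply: contraPneq nz => V0; have vi := indep _ V0.
    move: uv; rewrite V0 mulr0 addr0 => U0; have ui := indep _ U0.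
    by case=> -[i]; rewrite ?ui ?vi eqxx.
  have -> : F y = - F U / F V.
    apply: (canRL (mulfK _)); first by rewrite -(rmorph0 F) (inj_eq injF).
    by apply/eqP; rewrite -rmorphM -addr_eq0 -rmorphD addrC uv rmorph0.
  rewrite exprMn exprNn exprVn; apply: rpredM; last first.
    by rewrite rpredV pow_sum.
  by rewrite rpredM ?pow_sum // rpredX // rpredN rpred1.
have sS z : z \in S.
  by have [x [y ->]] := fracF z; rewrite rpred_div.
apply/separableP => y _.
have /adjoin_separableP := separable_generatorP {:L} 1%AS; apply; exact: sS.
Qed.

(** * The two characteristics *)

Lemma range_tofrac_integral (R : comNzRingType) (A : idomainType)
    (g : {rmorphism R -> A}) (w : seq A) :
  is_pid A -> (forall a, in_span g w a) ->
  range (@FracField.tofrac A) = integral_closure (tofrac \o g).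
Proof.
move=> pidA span_w; apply/seteqP; split=> [_ [a _ <-]|z /=].
  exact: integral_in_span span_w.
by case/(integrally_closed pidA) => a ->; exists a.
Qed.

Section Cases.

Variables (A : idomainType) (C : nat).
Hypothesis pidA : is_pid A.
Hypothesis finA : finite_quotients A.
Hypothesis C_gt0 : (0 < C)%N.
Local Notation N := (@ideal_norm A).
Hypothesis triN : forall x y, (N (x + y)%R <= C * (N x + N y))%N.
Variable pi : A.
Hypothesis pi_gt1 : (1 < N pi)%N.
Hypothesis pi_prime : forall a b, a * b \in principal_ideal pi ->
  a \in principal_ideal pi \/ b \in principal_ideal pi.

Local Notation K := {fraction A}.

(** Balls are finite, so the integers in [A] have unbounded norms and one of them
    can serve as the base of the expansions. *)
Lemma number_field_case : [pchar A] =i pred0 ->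
  number_field K /\
  range (@FracField.tofrac A) = integral_closure (fun n : int => n%:~R : K).
Proof.
move=> char0; pose g : {rmorphism int -> A} := intmul 1.
have natA n : (n%:R == 0 :> A) = (n == 0%N) by move/pcharf0P: char0; apply.
have inj_g : injective g.
  move=> m n /eqP; rewrite -subr_eq0 -rmorphB /= => mn.
  apply/eqP; rewrite -subr_eq0.
  move: mn; case: (m - n)%R => k; first by rewrite natA.
  by rewrite NegzE rmorphN oppr_eq0 natA.
have [s ballS] := ball_finite finA triN C.*2 pi_gt1.
have [n big_n] : exists n : int, (C.*2 <= N (g n))%N.
  apply: contrapT => small.
  have : (size [seq g (Posz i) | i <- iota 0 (size s).+1] <= size s)%N.
    apply: uniq_leq_size.
      by rewrite map_inj_uniq ?iota_uniq // => i j /inj_g[].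
    move=> _ /mapP[i _ ->]; apply: ballS; rewrite leqNgt; apply/negP => lt.
    by apply: small; exists (Posz i); rewrite ltnW.
  by rewrite size_map size_iota ltnn.
have [w span_w] := finitely_generated finA C_gt0 triN big_n.
split; last first.
  rewrite (range_tofrac_integral pidA span_w); congr integral_closure.
  by apply/funext => k; rewrite /= rmorph_int.
pose j : {rmorphism int -> rat} := intmul 1.
pose gK : {rmorphism int -> K} := tofrac \o g.
have [||e|h hj] := @extend_to_fractions _ _ _ j gK; first exact: intr_inj.
- by move=> m k /= /eqP; rewrite tofrac_eq => /eqP/inj_g.
- by exists (numq e), (denq e); rewrite denq_neq0 divq_num_den.
have [L [f [bij_f _]]] :=
  finite_extension (fun z => in_span_fraction z hj span_w).
by exists L, f.
Qed.

(** The base is [t = pi * s ^ p] with [s] a power of [pi]: its norm is large, its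
    [pi]-adic valuation is prime to [p], which makes the extension separable,
    and it is transcendental because it is not a unit. *)
Lemma function_field_case p : p \in [pchar A] ->
  exists F : finFieldType, function_field F K /\
   exists (iota : {rmorphism F -> K}) (t : K),
     ~ algebraicOver iota t /\
     range (@FracField.tofrac A) =
       integral_closure (fun q : {poly F} => (map_poly iota q).[t]).
Proof.
move=> charp; have p_prime := pcharf_prime charp.
have p0 := prime_gt0 p_prime.
have iota0 : {rmorphism 'F_p -> A} :=
  GRing.in_alg (pPrimeCharType charp)
    : {rmorphism 'F_p -> pPrimeCharType charp}.
pose s := pi ^+ C.*2; pose t := pi * s ^+ p.
have pi0 : pi != 0 by rewrite -(ideal_norm_gt0 finA) ltnW.
have s0 : s != 0 by rewrite expf_neq0.
have big_t : (C.*2 <= N t)%N.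
  rewrite /t /s -exprM -exprS ideal_normX //; apply: ltnW.
  by apply: leq_trans (ltn_expl _ pi_gt1) _; rewrite leq_exp2l //; nia.
have t1 : (1 < N t)%N by apply: leq_trans big_t; rewrite -addnn; lia.
have nunit_t : t \isn't a GRing.unit.
  by move: t1; rewrite ideal_norm_gt1 // => /andP[].
pose g : {rmorphism {poly 'F_p} -> A} := horner_eval t \o map_poly iota0.
have gE q : g q = (map_poly iota0 q).[t] by [].
(* The lowest nonzero coefficient of [q] is a unit of [A] that [t] would
   divide if [q] vanished at [t]. *)
have ker_g q : g q = 0 -> q = 0.
  elim/poly_ind: q => // q c IH.
  rewrite gE rmorphD rmorphM /= map_polyX map_polyC hornerMXaddC -gE.
  have [-> | c0] := eqVneq c 0.
    rewrite polyC0 raddf0 !addr0 => /eqP.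
    rewrite mulf_eq0 => /orP[/eqP/IH->|t0].
      by rewrite mul0r.
    by move: t1; rewrite (eqP t0) ideal_norm0.
  move/eqP; rewrite addr_eq0 => /eqP ct; case/negP: nunit_t.
  have: iota0 c \is a GRing.unit by rewrite rmorph_unit // unitfE.
  by rewrite -[iota0 c]opprK -ct unitrN unitrM => /andP[].
have inj_g : injective g.
  move=> q r /eqP; rewrite -subr_eq0 -rmorphB => /eqP/ker_g/eqP.
  by rewrite subr_eq0 => /eqP.
have gX : g 'X = t by rewrite gE map_polyX hornerX.
have [w span_w] : exists w : seq A, forall a, in_span g w a.
  by apply: (finitely_generated finA C_gt0 triN (r := 'X)); rewrite gX.
pose iota : {rmorphism 'F_p -> K} := tofrac \o iota0.
have evalK q : (map_poly iota q).[tofrac t] = tofrac (g q).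
  by rewrite gE map_poly_comp horner_map.
exists ('F_p : finFieldType); split; last first.
  exists iota, (tofrac t); split.
    case=> q /negP q0 /eqP; rewrite evalK => /eqP.
    rewrite tofrac_eq0 => /eqP/ker_g q00.
    by rewrite q00 eqxx in q0.
  rewrite (range_tofrac_integral pidA span_w); congr integral_closure.
  by apply/funext => q; rewrite evalK.
pose j : {rmorphism {poly 'F_p} -> {fraction {poly 'F_p}}} :=
  @FracField.tofrac _.
pose gK : {rmorphism {poly 'F_p} -> K} := tofrac \o g.
have [||e|h hj] := @extend_to_fractions _ _ _ j gK.
- by move=> q r /eqP; rewrite tofrac_eq => /eqP.
- by move=> q r /= /eqP; rewrite tofrac_eq => /eqP/inj_g.
- exact: fractionP.
have [L [f [bij_f fh]]] :=
  finite_extension (fun z => in_span_fraction z hj span_w).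
exists L; last by exists f.
pose F : {rmorphism A -> L} := f \o (@FracField.tofrac A).
apply: (@separable_of_relations _ L A F p t).
- by apply: (rmorph_pchar F).
- by move=> x y /fmorph_inj/eqP; rewrite tofrac_eq => /eqP.
- move=> z; case: bij_f => f' _ f'K; have [x [y [_ xy]]] := fractionP (f' z).
  by exists x, y; rewrite /= -fmorph_div -xy f'K.
- by rewrite /= -gX -[tofrac _]/(gK 'X) -hj fh; apply: rpredZ; apply: rpred1.
- move=> a; apply: (pth_powers_independent finA) => //.
by move=> y; apply: (pth_power_relation finA C_gt0 triN).
Qed.

End Cases.

Theorem theorem11 (A : idomainType)
    (hA : finite_quotient_pid A)
    (A_not_field : ~ GRing.field_axiom A)
    (hN : quasi_triangle (@ideal_norm A)) :
  global_field {fraction A} /\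
  ring_of_integers (range (@FracField.tofrac A)).
Proof.
have [pidA finA] := hA; have [C C_gt0 triN] := hN.
have [pi pi_gt1 pi_prime] := prime_exists pidA finA A_not_field.
have [char0|/existsNP[p charp]] := pselect ([pchar A] =i pred0).
  have [nfK rangeE] := number_field_case pidA finA C_gt0 triN pi_gt1 char0.
  by split; left.
have {}charp : p \in [pchar A] by apply/negPn/negP => /negPf.
have [F [ffK ringK]] := function_field_case pidA finA C_gt0 triN pi_gt1 pi_prime charp.
by split; right; exists F.
Qed.
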